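(* Suppose that for each $k\in\{1,\ldots,s\}$ there exist finite words $(\eta_1,\ldots,\eta_P)$ and $(\omega_1,\ldots,\omega_Q)$ over $\{1,\ldots,m\}$ (depending on $k$) such that $T_{\eta_1\ldots\eta_P}(a_k)\in\bigcup_{i=1}^s(a_i,b_i)$ and $T_{\omega_1\ldots\omega_Q}(b_k)\in\bigcup_{i=1}^s(a_i,b_i)$. Then the intervals $\{J_u\}_{u\in V}$, the directed graph $G=(V,E)$ and the similitudes $\{f_{uv}\}_{(u,v)\in E}$ defined in the context form a graph-directed construction, and its graph-directed self-similar set $K^*$ satisfies $K^*=U$. In particular, $U$ is a graph-directed self-similar set.
   Context: Let $f_j(x)=r_jx+d_j$, $1\le j\le m$, with $0<r_j<1$ and $d_j\in\mathbb{R}$, be an iterated function system on $\mathbb{R}$, and let $K$ be its attractor, i.e. the unique non-empty compact set with $K=\bigcup_{j=1}^m f_j(K)$. Assume $K=[a,b]$ is a (nondegenerate) interval. The projection map is $\pi:\{1,\ldots,m\}^{\mathbb{N}}\to K$, $\pi((i_n)_{n=1}^\infty)=\lim_{n\to\infty}f_{i_1}\circ\cdots\circ f_{i_n}(0)$; a coding of $x\in K$ is a sequence $(i_n)$ with $\pi((i_n))=x$. The univoque set $U$ is the set of $x\in K$ having exactly one coding, and $\widetilde U=\pi^{-1}(U)$. Put $T_j=f_j^{-1}$, $T_{i_1\ldots i_n}=T_{i_n}\circ\cdots\circ T_{i_1}$, $I_j=f_j(K)$. Let $H_1,\ldots,H_s$ be the non-empty intersections $I_i\cap I_j$ with $i\ne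 j$. It is assumed that each $H_k=[a_k,b_k]$ is a nontrivial interval contained in the interior of $K$, and that the $H_k$ are pairwise disjoint and listed from left to right. Graph-directed constructions. A graph-directed construction in $\mathbb{R}$ consists of: (1) finitely many pairwise disjoint bounded closed intervals $J_u$, $u\in V$ ($V$ a finite index set); (2) a directed graph $G=(V,E)$ such that every $u\in V$ has some $v\in V$ with $(u,v)\in E$; (3) for each edge $(u,v)\in E$ a similitude $f_{uv}(x)=r_{uv}x+a_{uv}$ with $r_{uv}\in(0,1)$, $a_{uv}\in\mathbb{R}$, such that for each $u\in V$, $\bigcup_{(u,v)\in E}f_{uv}(J_v)\subseteq J_u$ and the sets $f_{uv}(J_v)$, $(u,v)\in E$, are pairwise disjoint. For such a construction there is a unique vector $(C_u)_{u\in V}$ of non-empty compact sets with $C_u=\bigcup_{(u,v)\in E}f_{uv}(C_v)$ for all $u$; its graph-directed self-similar set is $K^*=\bigcup_{u\in V}C_u$. The specific construction (under the hypothesis of the claim). For each $k$ choose $\delta_{a_k},\delta_{b_k}>0$ such that $T_{\eta_1\ldots\eta_P}((a_k-\delta_{a_k},a_k))\subseteq\bigcup_i(a_i,b_i)$ and $T_{\omega_1\ldots\omega_Q}((b_k,b_k+\delta_{b_k}))\subseteq\bigcup_i(a_i,b_i)$ for the words belonging to $k$, and such that the intervals $[a_k-\delta_{a_k},b_k+\delta_{b_k}]$ are pairwise disjoint. Let $\delta=\min_k\{\delta_{a_k},\delta_{b_k}\}$ and fix $L\ge2$ such that every interval $f_{i_1}\circ\cdots\circ f_{i_L}(K)$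 has length less than $\delta$. Let $\mathbb{F}=\{(i_1,\ldots,i_L)\in\{1,\ldots,m\}^L: f_{i_1}\circ\cdots\circ f_{i_L}(K)\cap\bigcup_{k=1}^sH_k\neq\emptyset\}$ and $W=\{1,\ldots,m\}^L\setminus\mathbb{F}$. Let $V$ be the set of words $(a_1,\ldots,a_{L-1})\in\{1,\ldots,m\}^{L-1}$ for which some $a_L\in\{1,\ldots,m\}$ satisfies $(a_1,\ldots,a_L)\in W$. For $u=(u_1,\ldots,u_{L-1})$ and $v=(v_1,\ldots,v_{L-1})$ in $V$, put $(u,v)\in E$ iff $(u_2,\ldots,u_{L-1})=(v_1,\ldots,v_{L-2})$ and $(u_1,\ldots,u_{L-1},v_{L-1})\in W$. Vertices with no outgoing edge are removed (repeatedly), so that every $u\in V$ has an outgoing edge. For $u\in V$ let $K_u=\{\pi((d_n)_{n=1}^\infty): (d_n)\in\widetilde U,\ d_i=u_i\text{ for }1\le i\le L-1\}$ and let $J_u$ be the convex hull of $K_u$. For $(u,v)\in E$ let $f_{uv}=f_{u_1}$, i.e. $f_{uv}(x)=r_{u_1}x+d_{u_1}$. *)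

(* Defs.v *)
(* MathComp / MathComp-Analysis development. *)
From HB Require Import structures.
From mathcomp Require Import all_boot all_order all_algebra.
From mathcomp Require Import all_classical all_reals all_analysis.

Set Implicit Arguments.
Unset Strict Implicit.
Unset Printing Implicit Defensive.

Import Order.TTheory GRing.Theory Num.Theory.
Import numFieldTopology.Exports numFieldNormedType.Exports.

Local Open Scope classical_set_scope.
Local Open Scope ring_scope.

(** * Graph-directed constructions in the real line *)

Record gd_data (R : realType) := GDData {
  gd_vertex : finType;
  gd_edge : rel gd_vertex;
  gd_itv : gd_vertex -> set R;
  gd_ratio : gd_vertex -> gd_vertex -> R;
  gd_trans : gd_vertex -> gd_vertex -> R }.

(* Only meaningful when [(u, v)] is an edge. *)
Definition gd_map (R : realType) (G : gd_data R) (u v : gd_vertex G) (x : R) : R :=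
  gd_ratio u v * x + gd_trans u v.

(* A bounded closed interval is allowed to be reduced to a point: the convex
   hulls used below can be (e.g. the univoque set may consist of the two
   endpoints of the attractor only). *)
Definition gd_construction (R : realType) (G : gd_data R) : Prop :=
  [/\ forall u : gd_vertex G, exists p q : R, p <= q /\ gd_itv u = `[p, q]%classic,
      forall u v : gd_vertex G, u != v -> gd_itv u `&` gd_itv v = set0,
      forall u : gd_vertex G, exists v, gd_edge u v,
      forall u v : gd_vertex G, gd_edge u v -> 0 < gd_ratio u v < 1 &
      forall u : gd_vertex G,
        (\bigcup_(v in [set v | gd_edge u v]) (gd_map u v @` gd_itv v)
           `<=` gd_itv u) /\
        (forall v w : gd_vertex G, gd_edge u v -> gd_edge u w -> v != w ->
           (gd_map u v @` gd_itv v) `&` (gd_map u w @` gd_itv w) = set0)].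

Definition gd_invariant (R : realType) (G : gd_data R)
    (C : gd_vertex G -> set R) : Prop :=
  forall u, [/\ C u !=set0, compact (C u) &
    C u = \bigcup_(v in [set v | gd_edge u v]) (gd_map u v @` C v)].

(* [X] is the graph-directed self-similar set [K^*] of [G]; [unique P C] says
   that [C] satisfies [P] and is the only one to do so. *)
Definition is_gd_set (R : realType) (G : gd_data R) (X : set R) : Prop :=
  exists C : gd_vertex G -> set R,
    unique (@gd_invariant R G) C /\ X = \bigcup_u C u.

Definition gd_self_similar (R : realType) (X : set R) : Prop :=
  exists G : gd_data R, gd_construction G /\ is_gd_set G X.

(** * Iterated function systems [f_j x = r_j x + d_j] *)

Definition ifs_map (R : realType) (m : nat) (r d : 'I_m -> R) (j : 'I_m) (x : R) : R :=
  r j * x + d j.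

Definition is_attractor (R : realType) (m : nat) (r d : 'I_m -> R) (K : set R) : Prop :=
  [/\ K !=set0, compact K & K = \bigcup_j (ifs_map r d j @` K)].

(* [f_{i_1} \o ... \o f_{i_n}] for the word [w = i_1 ... i_n]. *)
Definition word_map (R : realType) (m : nat) (r d : 'I_m -> R)
    (w : seq 'I_m) (x : R) : R :=
  foldr (ifs_map r d) x w.

(* [T_j], the inverse of [f_j], defined on the whole line. *)
Definition inv_map (R : realType) (m : nat) (r d : 'I_m -> R) (j : 'I_m) (x : R) : R :=
  (x - d j) / r j.

(* [T_{i_1 ... i_n} = T_{i_n} \o ... \o T_{i_1}]. *)
Definition inv_word_map (R : realType) (m : nat) (r d : 'I_m -> R)
    (w : seq 'I_m) (x : R) : R :=
  foldl (fun y j => inv_map r d j y) x w.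

(* Codings are indexed from [0]: [c 0] is the first digit. *)
Definition coding_proj (R : realType) (m : nat) (r d : 'I_m -> R) (c : nat -> 'I_m) : R :=
  lim ((fun n => word_map r d (mkseq c n) 0) @ \oo).

Definition univoque (R : realType) (m : nat) (r d : 'I_m -> R) (K : set R) : set R :=
  [set x | K x /\ exists! c : nat -> 'I_m, coding_proj r d c = x].

Definition univoque_codes (R : realType) (m : nat) (r d : 'I_m -> R) (K : set R) :
    set (nat -> 'I_m) :=
  coding_proj r d @^-1` univoque r d K.

(* The intervals [[al k, be k]], in increasing order, are the distinct non-empty
   intersections [f_i(K) `&` f_j(K)], [i != j]; pairwise disjointness and the
   ordering from left to right are both expressed by [be k < al l] for
   [k < l]. *)
Definition overlaps (R : realType) (m : nat) (r d : 'I_m -> R) (K : set R)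
    (s : nat) (al be : 'I_s -> R) : Prop :=
  [/\ range (fun k => `[al k, be k]%classic) =
        [set X : set R | exists i j : 'I_m, [/\ i != j,
           X = (ifs_map r d i @` K) `&` (ifs_map r d j @` K) & X !=set0]],
      forall k, al k < be k,
      forall k, `[al k, be k]%classic `<=` K° &
      forall k l : 'I_s, (k < l)%N -> be k < al l].

Definition overlap_union (R : realType) (s : nat) (al be : 'I_s -> R) : set R :=
  \bigcup_k `[al k, be k]%classic.

Definition overlap_interiors (R : realType) (s : nat) (al be : 'I_s -> R) : set R :=
  \bigcup_k `]al k, be k[%classic.

(** * The construction attached to the univoque set *)

(* [dal k], [dbe k] are admissible radii around [[al k, be k]] for the words
   [eta k], [omega k]. *)
Definition admissible_radii (R : realType) (m : nat) (r d : 'I_m -> R)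
    (s : nat) (al be : 'I_s -> R) (eta omega : 'I_s -> seq 'I_m)
    (dal dbe : 'I_s -> R) : Prop :=
  [/\ forall k, 0 < dal k /\ 0 < dbe k,
      forall k, inv_word_map r d (eta k) @` `]al k - dal k, al k[%classic
                  `<=` overlap_interiors al be,
      forall k, inv_word_map r d (omega k) @` `]be k, be k + dbe k[%classic
                  `<=` overlap_interiors al be &
      forall k l : 'I_s, k != l ->
        `[al k - dal k, be k + dbe k]%classic `&` `[al l - dal l, be l + dbe l]%classic = set0].

(* The infimum is a minimum, taken over a finite set. *)
Definition min_radius (R : realType) (s : nat) (dal dbe : 'I_s -> R) : R :=
  inf (range dal `|` range dbe).

(* From here on the word length is [L = l.+2], so that [l : nat] ranges over all
   [L >= 2], and vertices are words of length [L - 1 = l.+1].  As the ratios are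
   positive, the image of [[a, b]] under [word_map r d w] is the interval with
   endpoints [word_map r d w a] and [word_map r d w b]. *)
Definition admissible_length (R : realType) (m : nat) (r d : 'I_m -> R) (a b : R)
    (s : nat) (dal dbe : 'I_s -> R) (l : nat) : Prop :=
  forall w : l.+2.-tuple 'I_m,
    word_map r d w b - word_map r d w a < min_radius dal dbe.

(* The set [W] of words. *)
Definition allowed (R : realType) (m : nat) (r d : 'I_m -> R) (K : set R)
    (s : nat) (al be : 'I_s -> R) (l : nat) : {set l.+2.-tuple 'I_m} :=
  [set w : l.+2.-tuple 'I_m |
     ~~ `[< (word_map r d w @` K) `&` overlap_union al be !=set0 >]]%SET.

Definition pre_vertices (m l : nat) (W : {set l.+2.-tuple 'I_m}) :
    {set l.+1.-tuple 'I_m} :=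
  [set u : l.+1.-tuple 'I_m | [exists i : 'I_m, [tuple of rcons u i] \in W]]%SET.

Definition word_edge (m l : nat) (W : {set l.+2.-tuple 'I_m})
    (u v : l.+1.-tuple 'I_m) : bool :=
  (behead u == take l v) && ([tuple of rcons u (tnth v ord_max)] \in W).

Definition prune (m l : nat) (W : {set l.+2.-tuple 'I_m})
    (A : {set l.+1.-tuple 'I_m}) : {set l.+1.-tuple 'I_m} :=
  [set u in A | [exists v in A, word_edge W u v]]%SET.

(* The removal is stationary after as many rounds as there are initial vertices,
   since every round before that removes at least one of them. *)
Definition vertices (m l : nat) (W : {set l.+2.-tuple 'I_m}) :
    {set l.+1.-tuple 'I_m} :=
  iter #|pre_vertices W| (prune W) (pre_vertices W).

Definition univoque_cylinder (R : realType) (m : nat) (r d : 'I_m -> R) (K : set R)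
    (l : nat) (u : l.+1.-tuple 'I_m) : set R :=
  coding_proj r d @` [set c | univoque_codes r d K c /\ forall i : 'I_l.+1, c i = tnth u i].

Definition univoque_gd (R : realType) (m : nat) (r d : 'I_m -> R) (K : set R)
    (s : nat) (al be : 'I_s -> R) (l : nat) : gd_data R :=
  let W := allowed r d K al be l in
  @GDData R {u : l.+1.-tuple 'I_m | u \in vertices W}
    (fun u v => word_edge W (val u) (val v))
    (fun u => [set` Rhull (univoque_cylinder r d K (val u))])
    (fun u _ => r (thead (val u)))
    (fun u _ => d (thead (val u))).

(* Main.v *)
Require Import Defs.
From HB Require Import structures.
From mathcomp Require Import all_boot all_order all_algebra.
From mathcomp Require Import all_classical all_reals all_analysis.
From mathcomp Require Import lra.

Set Implicit Arguments.
Unset Strict Implicit.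
Unset Printing Implicit Defensive.

Import Order.TTheory GRing.Theory Num.Theory.
Import numFieldTopology.Exports numFieldNormedType.Exports.

Local Open Scope classical_set_scope.
Local Open Scope ring_scope.

(** A coding of [x] is an itinerary of [x] under the inverse branches [T_j]
    that never leaves [[a, b]]; there is a choice of branch exactly when the
    current point lies in two of the intervals [I_j], so a coding is unique
    exactly when its orbit avoids the overlaps [H_k]
    ([univoque_codes_avoid]).

    The words attached to the endpoints of the overlaps turn this into a
    condition of finite type.  If a univoque orbit came within the minimal
    radius of some [H_k], then [T_eta] or [T_omega] would send the current
    point into the interior of an overlap; but an image of a univoque point
    that stays in the attractor is univoque ([univoque_codes_suffix]), hence
    in no overlap.  So univoque orbits keep a definite distance from the
    overlaps, and as the intervals of level [L] are shorter than that
    distance, a code is univoque exactly when all its blocks of length [L]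
    belong to [W] ([allowed_code_univoque], [univoque_allowed_code]).  These
    codes are the infinite paths of the pruned graph ([vertex_code],
    [path_allowed_code], [allowed_code_vertex]).

    It follows that the cylinders [K_u] are non-empty and satisfy the equations
    of the graph.  A bounded family of sets, each contained in the union of the
    images prescribed by the graph, is contained in the family [K_u], because
    its points can be followed backwards along an infinite path
    ([subinvariant_cylinder]).  Applied to the closures of the [K_u], this gives
    compactness ([univoque_cylinder_compact]); applied to any invariant family,
    it gives one half of uniqueness.  The other half holds because a point of
    [K_u] is a limit of images of points of the given family along its path
    ([gd_invariant_cylinder]).

    The hulls [J_u] are pairwise disjoint because two univoque points whose
    first digits [i] and [j] differ lie in [I_i] minus [I_j] and in [I_j] minus
    [I_i]; when both differences of two intervals are non-empty, one lies
    entirely to the left of the other ([first_level_separated],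
    [cylinder_hulls_disjoint]). *)

(** * Shifting codes *)

Definition shift_code (T : Type) (n : nat) (c : nat -> T) : nat -> T :=
  fun i => c (n + i)%N.

Definition cons_code (T : Type) (j : T) (c : nat -> T) : nat -> T :=
  fun i => if i is i'.+1 then c i' else j.

Lemma mkseq_cons (T : Type) (c : nat -> T) n :
  mkseq c n.+1 = c 0%N :: mkseq (shift_code 1 c) n.
Proof. by rewrite /mkseq /= (iotaDl 1 0) -map_comp. Qed.

Lemma cons_shift_code (T : Type) (c : nat -> T) :
  cons_code (c 0%N) (shift_code 1 c) = c.
Proof. by apply: funext => -[]. Qed.

Lemma shift_code0 (T : Type) (c : nat -> T) n : shift_code n c 0%N = c n.
Proof. by rewrite /shift_code addn0. Qed.

Lemma shift_codeS (T : Type) (c : nat -> T) n :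
  shift_code 1 (shift_code n c) = shift_code n.+1 c.
Proof. by apply: funext => i; rewrite /shift_code addnCA. Qed.

(** * Codings of the attractor *)

Section Coding.
Variables (R : realType) (m : nat) (r d : 'I_m -> R).
Hypothesis hr : forall j, 0 < r j < 1.
Variables (a b : R).
Hypothesis hK : is_attractor r d `[a, b]%classic.

Local Notation f := (ifs_map r d).
Local Notation K := (`[a, b]%classic : set R).
Local Notation proj := (coding_proj r d).

Lemma word_map_cons j w x : word_map r d (j :: w) x = f j (word_map r d w x).
Proof. by []. Qed.

Lemma ifs_map_le j : {mono f j : x y / x <= y}.
Proof.
by move=> x y; rewrite /ifs_map lerD2r ler_pM2l//; case/andP: (hr j).
Qed.

Lemma ifs_map_inj j : injective (f j).
Proof. exact: (inc_inj (ifs_map_le j)). Qed.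

Lemma ifs_map_continuous j : continuous (f j).
Proof.
by move=> x; apply: cvgD; [exact: cvgMr|exact: cvg_cst].
Qed.

Lemma inv_mapK j x : f j (inv_map r d j x) = x.
Proof.
have /andP[rj _] := hr j.
by rewrite /ifs_map /inv_map mulrC divfK ?gt_eqF// subrK.
Qed.

Lemma inv_word_mapK w x : word_map r d w (inv_word_map r d w x) = x.
Proof.
elim: w x => // j w IH x; rewrite word_map_cons.
by rewrite -[inv_word_map _ _ _ _]/(inv_word_map r d w _) IH inv_mapK.
Qed.

Lemma inv_word_map_continuous w : continuous (inv_word_map r d w).
Proof.
elim: w => [|j w IH] x; first exact: cvg_id.
apply: (@continuous_comp _ _ _ (inv_map r d j) (inv_word_map r d w)).
  by apply: cvgMl; apply: cvgB; [exact: cvg_id|exact: cvg_cst].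
exact: IH.
Qed.

(** Word maps are affine, with slope the product of the ratios. *)
Lemma word_map_sub w x y :
  word_map r d w x - word_map r d w y = (\prod_(j <- w) r j) * (x - y).
Proof.
elim: w => [|j w IH]; first by rewrite big_nil mul1r.
by rewrite !word_map_cons big_cons -mulrA -IH /ifs_map; lra.
Qed.

Lemma word_map_le w : {mono word_map r d w : x y / x <= y}.
Proof.
move=> x y; rewrite -subr_ge0 word_map_sub pmulr_rge0 ?subr_ge0//.
by apply: prodr_gt0 => j _; case/andP: (hr j).
Qed.

Definition max_ratio : R := \big[Num.max/0]_j r j.

Lemma max_ratio_lt1 : `|max_ratio| < 1.
Proof.
rewrite ger0_norm; last exact: bigmax_ge_id.
by apply: bigmax_lt => // j _; case/andP: (hr j).
Qed.

Lemma word_map_lip w x y :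
  `|word_map r d w x - word_map r d w y| <= max_ratio ^+ size w * `|x - y|.
Proof.
rewrite word_map_sub normrM ler_wpM2r//.
elim: w => [|j w IH]; first by rewrite big_nil normr1.
have /andP[rj _] := hr j.
rewrite big_cons normrM exprS ler_pM// gtr0_norm//.
exact: le_bigmax.
Qed.

Lemma ifs_map_itv j x : K x -> K (f j x).
Proof.
by case: hK => _ _ KE Kx; rewrite KE; exists j => //; exists x.
Qed.

Lemma word_map_itv w x : K x -> K (word_map r d w x).
Proof. by elim: w => // j w IH /IH; exact: ifs_map_itv. Qed.

Lemma word_map_image w y :
  (word_map r d w @` K) y <-> word_map r d w a <= y <= word_map r d w b.
Proof.
split=> [[x]|/andP[ay yb]]; first by rewrite /= in_itv/= => xK <-; rewrite !word_map_le.
exists ((y - word_map r d w 0) / \prod_(j <- w) r j); last first.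
  have P0 : \prod_(j <- w) r j != 0.
    by rewrite gt_eqF//; apply: prodr_gt0 => j _; case/andP: (hr j).
  rewrite -[LHS](subrK (word_map r d w 0)) word_map_sub subr0 mulrC.
  by rewrite divfK// subrK.
have P0 : 0 < \prod_(j <- w) r j by apply: prodr_gt0 => j _; case/andP: (hr j).
rewrite /= in_itv/= ler_pdivlMr// ler_pdivrMr//.
have := word_map_sub w a 0; have := word_map_sub w b 0.
by rewrite !subr0 !(mulrC _ (\prod_(j <- w) r j)) => <- <-; rewrite !lerB.
Qed.

Lemma ifs_image j y : (f j @` K) y <-> f j a <= y <= f j b.
Proof. exact: (word_map_image [:: j]). Qed.

Lemma attractor_le : a <= b.
Proof.
case: hK => -[x]; rewrite /= in_itv/= => /andP[ax xb] _ _; exact: le_trans xb.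
Qed.

Lemma word_map_diff_cvg0 (c : nat -> 'I_m) (z t : nat -> R) M :
  (forall n, `|z n - t n| <= M) ->
  (word_map r d (mkseq c n) (z n) - word_map r d (mkseq c n) (t n)) @[n --> \oo]
    --> (0 : R).
Proof.
move=> zM; apply/cvgr0Pnorm_le => e e0.
have : (max_ratio ^+ n * M) @[n --> \oo] --> (0 : R).
  by rewrite -[0](mul0r M); apply: cvgMl; exact: cvg_expr max_ratio_lt1.
move/cvgr0Pnorm_le => /(_ _ e0); apply: filterS => n.
apply: le_trans; apply: le_trans (word_map_lip _ _ _) _.
rewrite size_mkseq; apply: le_trans (ler_norm _).
by rewrite ler_wpM2l// exprn_ge0//; exact: bigmax_ge_id.
Qed.

(** The base point [0] of the projection can be replaced by any bounded
    sequence of base points, since word maps contract; with base point [a] the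
    sequence is nondecreasing and bounded by [b], which gives convergence. *)
Lemma coding_proj_cvg (c : nat -> 'I_m) (z : nat -> R) M : (forall n, `|z n| <= M) ->
  word_map r d (mkseq c n) (z n) @[n --> \oo] --> proj c.
Proof.
have aK : K a by rewrite /= in_itv/= lexx attractor_le.
have cva : cvgn (fun n => word_map r d (mkseq c n) a).
  apply: nondecreasing_is_cvgn.
    apply/nondecreasing_seqP => n.
    rewrite mkseqS /word_map foldr_rcons -/(word_map r d _ _) word_map_le.
    by have := ifs_map_itv (c n) aK; rewrite /= in_itv/= => /andP[].
  exists b => _ [n _ <-].
  by have := word_map_itv (mkseq c n) aK; rewrite /= in_itv/= => /andP[].
suff cv z' M' : (forall n, `|z' n| <= M') ->
    word_map r d (mkseq c n) (z' n) @[n --> \oo] -->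
    limn (fun n => word_map r d (mkseq c n) a).
  rewrite /coding_proj (cvg_lim _ (cv (fun=> 0) 0 _))//.
  - exact: cv.
  - by move=> n; rewrite normr0.
move=> zM.
rewrite -[X in _ --> X](add0r).
under eq_fun => n do rewrite -(subrK (word_map r d (mkseq c n) a) (word_map r d _ _)).
apply: cvgD => //; apply: (@word_map_diff_cvg0 c z' (fun=> a) (M' + `|a|)) => n.
by rewrite (le_trans (ler_normB _ _))// lerD2r.
Qed.

Lemma coding_proj_cons c : proj c = f (c 0%N) (proj (shift_code 1 c)).
Proof.
have h n : `|(fun _ : nat => 0 : R) n| <= (0 : R) by rewrite normr0.
have := @coding_proj_cvg c _ _ h; rewrite -(cvg_shiftS _) => /cvg_unique; apply => //.
have -> : [sequence word_map r d (mkseq c n.+1) 0]_n =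
    f (c 0%N) \o (fun n => word_map r d (mkseq (shift_code 1 c) n) 0).
  by apply: funext => n; exact: (congr1 (fun w => word_map r d w 0) (mkseq_cons c n)).
apply: (@cvg_comp _ _ _ (fun n => word_map r d (mkseq (shift_code 1 c) n) 0)).
  exact: (@coding_proj_cvg (shift_code 1 c) _ _ h).
exact: ifs_map_continuous.
Qed.

(** Recognises a coding of [z 0] from a bounded backward orbit; the bound is
    arbitrary, as the orbits met below need not be known to lie in [[a, b]]. *)
Lemma coding_orbit (c : nat -> 'I_m) (z : nat -> R) M :
  (forall n, `|z n| <= M) -> (forall n, z n = f (c n) (z n.+1)) -> proj c = z 0%N.
Proof.
move=> zM zE; have /cvg_unique := @coding_proj_cvg c _ _ zM; apply => //.
suff zn n : word_map r d (mkseq c n) (z n) = z 0%N.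
  by rewrite (funext zn); exact: cvg_cst.
elim: n => // n <-.
by rewrite mkseqS /word_map foldr_rcons [in RHS]zE.
Qed.

(** Iterate a choice, for each point of the attractor, of one of the [f_j @` K]
    that contain it. *)
Lemma exists_coding x : K x -> exists c, proj c = x.
Proof.
move=> Kx; pose X := {x : R | K x}.
have [g gP] : {g : X -> 'I_m * X & forall x, f (g x).1 (sval (g x).2) = sval x}.
  apply: (@choice _ _ (fun x (y : 'I_m * X) => f y.1 (sval y.2) = sval x)) => -[y Ky].
  have : (\bigcup_j (f j @` K)) y by case: hK => _ _ <-.
  by move=> [j _ [z Kz zE]]; exists (j, exist _ z Kz).
pose z n := iter n (fun y => (g y).2) (exist _ x Kx : X).
exists (fun n => (g (z n)).1).
rewrite (@coding_orbit _ (fun n => sval (z n)) (`|a| + `|b|))// => n.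
  case: (z n) => y /=; rewrite in_itv/= => /andP[ay yb].
  have := ler_norm b; have := ler_norm (- a); rewrite normrN => ha hb.
  have := normr_ge0 a; have := normr_ge0 b.
  by move=> ? ?; rewrite ler_norml; apply/andP; split; lra.
Qed.

Lemma coding_proj_itv c : K (proj c).
Proof.
have aK : K a by rewrite /= in_itv/= lexx attractor_le.
apply: (@closed_cvg _ _ \oo _ (fun n => word_map r d (mkseq c n) a)).
- exact: interval_closed.
- by apply: nearW => n; exact: word_map_itv.
- exact: (@coding_proj_cvg c (fun=> a) `|a|).
Qed.

Lemma coding_proj_word c n :
  proj c = word_map r d (mkseq c n) (proj (shift_code n c)).
Proof.
elim: n c => // n IH c.
by rewrite mkseq_cons word_map_cons coding_proj_cons (IH (shift_code 1 c)).
Qed.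

Local Notation univ := (univoque_codes r d K).

Lemma univoque_codesP c : univ c <-> forall e, proj e = proj c -> e = c.
Proof.
split=> [[_ [c' [_ c'U]] e eE]|h]; first by rewrite -(c'U e eE) -(c'U c erefl).
split; first exact: coding_proj_itv.
by exists c; split=> // e /h.
Qed.

Lemma univoque_codes_cons j c : univ (cons_code j c) -> univ c.
Proof.
move=> /univoque_codesP h; apply/univoque_codesP => e eE.
suff : cons_code j e = cons_code j c by move/(congr1 (shift_code 1)).
by apply: h; rewrite [LHS]coding_proj_cons -[shift_code 1 _]/(e) eE [RHS]coding_proj_cons.
Qed.

Lemma univoque_codes_shift n c : univ c -> univ (shift_code n c).
Proof.
elim: n c => // n IH c h; apply: (IH (shift_code 1 c)).
by apply: (@univoque_codes_cons (c 0%N)); rewrite cons_shift_code.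
Qed.

(** If [T_w] sends a univoque point to a point that has a coding, then that
    point is univoque: putting [w] in front of two of its codings would give
    two codings of the former point. *)
Lemma univoque_codes_suffix w c e :
  univ c -> proj c = word_map r d w (proj e) -> univ e.
Proof.
elim: w c => [|j w IH] c cU.
  by move/univoque_codesP: (cU) => h /esym/h ->.
have [e' e'E] : exists e', proj e' = word_map r d w (proj e).
  by apply: exists_coding; apply: word_map_itv; exact: coding_proj_itv.
rewrite word_map_cons -e'E => cE.
have cE' : cons_code j e' = c.
  by move/univoque_codesP: cU; apply; rewrite coding_proj_cons cE.
apply: IH e'E; apply: (@univoque_codes_cons j); by rewrite cE'.
Qed.

(** A point of [f_j @` K] has a coding that starts with [j]. *)
Lemma univoque_codes_digit c j : univ c -> (f j @` K) (proj c) -> j = c 0%N.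
Proof.
move=> /univoque_codesP cU [y Ky yE]; have [e eE] := exists_coding Ky.
by rewrite -(cU (cons_code j e))// coding_proj_cons /= -yE -eE.
Qed.

Lemma univoque_codesI c :
  (forall n j, (f j @` K) (proj (shift_code n c)) -> j = c n) -> univ c.
Proof.
move=> h; apply/univoque_codesP => e eE.
have digitE n : proj (shift_code n e) = proj (shift_code n c) -> e n = c n.
  move=> En; apply: h; exists (proj (shift_code n.+1 e)); first exact: coding_proj_itv.
  by rewrite -En [RHS]coding_proj_cons shift_codeS shift_code0.
apply: funext => n; apply: (digitE n).
elim: n => // n IH; have := IH; rewrite !(coding_proj_cons (shift_code n _)).
by rewrite !shift_code0 (digitE _ IH) !shift_codeS => /ifs_map_inj.
Qed.

End Coding.

(** * The convex hull of a compact set *)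

(** The hull is a closed interval because a compact set attains its bounds. *)
Lemma Rhull_compact (R : realType) (X : set R) : X !=set0 -> compact X ->
  exists p q, [/\ X p, X q, X `<=` `[p, q] & [set` Rhull X] = `[p, q]%classic].
Proof.
move=> X0 cX.
have cid : {within X, continuous (@id R)} by apply: continuous_subspaceT => x; exact: cvg_id.
have [q qX qmax] := compact_EVT_max X0 cX cid.
have [p pX pmin] := compact_EVT_min X0 cX cid.
move: qX pX; rewrite !inE => qX pX.
have Xpq : X `<=` `[p, q].
  by move=> x Xx; rewrite /= in_itv/= pmin ?qmax// inE.
exists p, q; split=> //.
have hl : has_lbound X by exists p => x /Xpq; rewrite /= in_itv/= => /andP[].
have hu : has_ubound X by exists q => x /Xpq; rewrite /= in_itv/= => /andP[].
have infE : inf X = p.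
  apply/eqP; rewrite eq_le ge_inf//=; apply: lb_le_inf => // x /Xpq.
  by rewrite /= in_itv/= => /andP[].
have supE : sup X = q.
  apply/eqP; rewrite eq_le ub_le_sup// andbT; apply: ge_sup => // x /Xpq.
  by rewrite /= in_itv/= => /andP[].
by rewrite /Rhull infE supE !asboolT.
Qed.

(** * Infinite paths of the pruned word graph *)

Section WordGraph.
Variables (m l : nat) (W : {set l.+2.-tuple 'I_m}).

Definition code_prefix k (c : nat -> 'I_m) : k.-tuple 'I_m := [tuple of mkseq c k].

(** For the set [W] of the construction these turn out to be the univoque
    codes. *)
Definition allowed_code (c : nat -> 'I_m) : Prop :=
  forall n, code_prefix l.+2 (shift_code n c) \in W.

(** Both sides are the word of length [l.+2] carried by the edge. *)
Lemma word_edge_cons (u v : l.+1.-tuple 'I_m) :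
  word_edge W u v -> rcons u (tnth v ord_max) = thead u :: v.
Proof.
case/andP; case/tupleP: u => x u /= /eqP uv _; rewrite theadE uv; congr (_ :: _).
rewrite (tnth_nth x v ord_max) -take_nth ?size_tuple//.
by rewrite take_oversize// size_tuple.
Qed.

Lemma prune_sub A : prune W A \subset A.
Proof. by apply/fintype.subsetP => u; rewrite inE => /andP[]. Qed.

(** As long as a round of pruning is not stationary it removes a vertex, so
    after as many rounds as there are vertices either pruning is stationary or
    nothing is left. *)
Lemma prune_vertices : prune W (vertices W) = vertices W.
Proof.
set A := pre_vertices W.
(* After [n] rounds without a stationary one, [n] vertices are gone. *)
suff claim n : prune W (iter n (prune W) A) = iter n (prune W) A \/
    (#|iter n (prune W) A| + n <= #|A|)%N.
  case: (claim #|A|) => // h.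
  suff E : vertices W = finset.set0 by apply/eqP; rewrite E -finset.subset0 prune_sub.
  by apply/eqP; rewrite -cards_eq0 -leqn0 -(leq_add2r #|A|).
elim: n => [|n IH]; first by right; rewrite addn0.
have [E|/eqP NE] := altP (prune W (iter n (prune W) A) =P iter n (prune W) A).
  by left; rewrite iterS !E.
right; case: IH => // h; apply: leq_trans h; rewrite addnS ltn_add2r iterS.
by apply: proper_card; rewrite finset.properEneq prune_sub andbT; apply/eqP.
Qed.

Lemma vertices_next u : u \in vertices W ->
  exists2 v, v \in vertices W & word_edge W u v.
Proof. by rewrite -{1}prune_vertices inE => /andP[_ /exists_inP]. Qed.

Lemma allowed_code_shift n c : allowed_code c -> allowed_code (shift_code n c).
Proof.
move=> h k; have := h (n + k)%N; congr (code_prefix _ _ \in W).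
by apply: funext => i; rewrite /shift_code addnA.
Qed.

Lemma allowed_code_edge c : allowed_code c ->
  word_edge W (code_prefix l.+1 c) (code_prefix l.+1 (shift_code 1 c)).
Proof.
move=> h; apply/andP; split.
  change (behead (mkseq c l.+1) == take l (mkseq (shift_code 1 c) l.+1)).
  by rewrite mkseq_cons [X in take l X]mkseqS -cats1 take_size_cat// size_mkseq.
have := h 0%N; congr (_ \in W); apply: val_inj.
rewrite [LHS]mkseqS (tnth_nth (c 0%N)); congr (rcons _ _).
by rewrite nth_mkseq.
Qed.

(** The prefixes of all the shifts of the code survive each round of pruning
    together, as each has the next one as a successor. *)
Lemma allowed_code_vertex c : allowed_code c -> code_prefix l.+1 c \in vertices W.
Proof.
rewrite /vertices; elim: #|_| c => [|n IH] c h.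
  rewrite inE; apply/existsP; exists (c l.+1).
  have := h 0%N; congr (_ \in W); apply: val_inj.
  exact: mkseqS.
rewrite iterS inE IH//=; apply/exists_inP.
exists (code_prefix l.+1 (shift_code 1 c)); last exact: allowed_code_edge.
by apply: IH; exact: allowed_code_shift.
Qed.

(** Consecutive vertices overlap in all letters but one, so a path is
    determined by the first letters of its vertices. *)
Lemma path_code_prefix (p : nat -> l.+1.-tuple 'I_m) :
  (forall n, word_edge W (p n) (p n.+1)) ->
  forall n, code_prefix l.+1 (shift_code n (fun k => thead (p k))) = p n.
Proof.
move=> pE n; apply: val_inj; set c := fun k => thead (p k).
apply: (@eq_from_nth _ (c 0%N)) => [|i]; first by rewrite !size_tuple.
rewrite size_tuple => il; rewrite nth_mkseq// /shift_code.
elim: i n il => [|i IH] n il.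
  by rewrite addn0 /c /thead (tnth_nth (thead (p 0%N))).
rewrite addnS -addSn IH ?(ltnW il)//.
have /(congr1 (fun s => nth (c 0%N) s i.+1)) := word_edge_cons (pE n).
by rewrite nth_rcons size_tuple il /= => ->.
Qed.

Lemma path_allowed_code (p : nat -> l.+1.-tuple 'I_m) :
  (forall n, word_edge W (p n) (p n.+1)) -> allowed_code (fun k => thead (p k)).
Proof.
move=> pE n; have /andP[_] := pE n; congr (_ \in W); apply: val_inj.
rewrite [LHS](word_edge_cons (pE n)) [RHS]mkseq_cons shift_codeS shift_code0.
by congr (_ :: _); rewrite -(path_code_prefix pE).
Qed.

(** Prepending the first letter of [u] to a code that follows the edge out of
    [u] creates one new block, the word carried by the edge. *)
Lemma edge_cons_code u c : word_edge W u (code_prefix l.+1 c) ->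
  code_prefix l.+2 (cons_code (thead u) c) \in W /\
  code_prefix l.+1 (cons_code (thead u) c) = u.
Proof.
move=> uE; have := word_edge_cons uE; case/andP: uE => _ uW.
have -> : thead u :: code_prefix l.+1 c = mkseq (cons_code (thead u) c) l.+2.
  by rewrite mkseq_cons.
move=> E; split.
  by move: uW; congr (_ \in W); apply: val_inj.
by move/eqP: E; rewrite mkseqS eqseq_rcons => /andP[/eqP E _]; apply/val_inj.
Qed.

Lemma allowed_code_cons u c : word_edge W u (code_prefix l.+1 c) ->
  allowed_code c -> allowed_code (cons_code (thead u) c).
Proof. by move=> /edge_cons_code[uW _] cW [|n]; [exact: uW|exact: (cW n)]. Qed.

Lemma vertex_code u : u \in vertices W ->
  exists2 c, allowed_code c & code_prefix l.+1 c = u.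
Proof.
move=> uV; pose V := {u | u \in vertices W}.
have [g gP] : {g : V -> V & forall u, word_edge W (val u) (val (g u))}.
  apply: (@choice _ _ (fun u v : V => word_edge W (val u) (val v))) => -[x xV].
  by have [v vV xv] := vertices_next xV; exists (exist _ v vV).
pose p n := val (iter n g (exist _ u uV : V)).
have pE n : word_edge W (p n) (p n.+1) by exact: gP.
exists (fun k => thead (p k)); first exact: path_allowed_code.
by have := path_code_prefix pE 0.
Qed.

End WordGraph.


(** * Overlaps and univoque codes *)

Section Overlaps.
Variables (R : realType) (m : nat) (r d : 'I_m -> R).
Hypothesis hr : forall j, 0 < r j < 1.
Variables (a b : R).
Hypothesis hab : a < b.
Hypothesis hK : is_attractor r d `[a, b]%classic.
Variables (s : nat) (al be : 'I_s -> R).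
Hypothesis hH : overlaps r d `[a, b]%classic al be.

Local Notation f := (ifs_map r d).
Local Notation K := (`[a, b]%classic : set R).
Local Notation proj := (coding_proj r d).
Local Notation univ := (univoque_codes r d K).

Lemma overlap_unionP y : overlap_union al be y <->
  exists i j, [/\ i != j, (f i @` K) y & (f j @` K) y].
Proof.
case: hH => hR _ _ _; split=> [[k _ ky]|[i [j [ij iy jy]]]].
  have : range (fun k => `[al k, be k]%classic) `[al k, be k]%classic by exists k.
  by rewrite hR => -[i [j [ij E _]]]; exists i, j; move: ky; rewrite E => -[].
have : [set X | exists i j, [/\ i != j, X = (f i @` K) `&` (f j @` K) & X !=set0]]
    ((f i @` K) `&` (f j @` K)).
  by exists i, j; split=> //; exists y.
by rewrite -hR => -[k _ kE]; exists k => //; rewrite kE.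
Qed.

Lemma overlap_interiors_sub : overlap_interiors al be `<=` overlap_union al be.
Proof. by move=> y [k _ ky]; exists k => //; exact: subset_itv_oo_cc. Qed.

(** Two different digits are possible at step [n] exactly when the [n]-th point
    of the orbit lies in two of the sets [f_i @` K]. *)
Lemma univoque_codes_avoid c :
  univ c <-> forall n, ~ overlap_union al be (proj (shift_code n c)).
Proof.
split=> [cU n /overlap_unionP[i [j [/eqP ij iy jy]]]|h].
  have nU := univoque_codes_shift hr hK n cU; apply: ij.
  by rewrite (univoque_codes_digit hr hK nU iy) (univoque_codes_digit hr hK nU jy).
apply: (univoque_codesI hr hK) => n j jn; apply/eqP/negP => /negP jc.
apply: (h n); apply/overlap_unionP; exists j, (c n); split=> //.
exists (proj (shift_code n.+1 c)); first exact: coding_proj_itv.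
by rewrite [RHS](coding_proj_cons hr hK) shift_code0 shift_codeS.
Qed.

(** A point [f_j b] with [a] in [f_j @` K] lies strictly inside [[a, b]]; the
    points to its right are covered by the finitely many other sets
    [f_i @` K], which are closed, so one of them contains it. *)
Lemma overlap_exists : (0 < s)%N.
Proof.
have [j jE] : exists j, f j a <= a <= f j b.
  have : K a by rewrite /= in_itv/= lexx ltW.
  by case: (hK) => _ _ {1}-> [j _ aj]; exists j; apply/(ifs_image d hr).
have /andP[rj0 rj1] := hr j.
(* [f j] contracts and moves [a] to a point not to its right. *)
have jb : f j b < b.
  have : f j a <= a by case/andP: jE.
  rewrite /ifs_map => h.
  have : 0 < (1 - r j) * (b - a) by rewrite mulr_gt0 ?subr_gt0.
  by rewrite mulrBl !mulrBr !mul1r; lra.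
have clo i : closed (f i @` K).
  apply: compact_closed; first exact: Rhausdorff.
  apply: continuous_compact; last exact: segment_compact.
  by apply: continuous_subspaceT => x; exact: ifs_map_continuous.
have cloU : closed (\bigcup_(i in [set i | i != j]) (f i @` K)).
  by apply: closed_bigcup => [|i _]; [exact: finite_finset|exact: clo].
have jbU : (\bigcup_(i in [set i | i != j]) (f i @` K)) (f j b).
  suff nearU : \forall y \near (f j b)^'+,
      (\bigcup_(i in [set i | i != j]) (f i @` K)) (idfun y).
    by apply: (closed_cvg _ cloU nearU); exact: cvg_within.
  near=> y.
  have Ky : K y.
    rewrite /= in_itv/=; apply/andP; split; last by near: y; exact: nbhs_right_le.
    by apply: (le_trans (y := f j b)); [case/andP: jE|near: y; exact: nbhs_right_ge].
  move: Ky; case: (hK) => _ _ {1}-> [i _ iy]; exists i => //=.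
  apply/eqP => ij; move: iy; rewrite ij => /(ifs_image d hr) /andP[_].
  by apply/negP; rewrite -ltNge; near: y; exact: nbhs_right_gt.
case: jbU => i ij ib.
have [k _ _] : overlap_union al be (f j b).
  by apply/overlap_unionP; exists i, j; split=> //; exists b => //=; rewrite in_itv/= lexx ltW.
exact: leq_ltn_trans (ltn_ord k).
Unshelve. all: by end_near. Qed.

Lemma near_right0_preimage (g : R -> R) (x : R) (O : set R) :
  {for x, continuous g} -> open O -> O (g x) ->
  \forall e \near 0^'+, forall y, `|x - y| < e -> O (g y).
Proof.
move=> cg oO Ogx.
have /nbhs_normP[e /= e0 he] : nbhs x (g @^-1` O) by apply: cg; exact: open_nbhs_nbhs.
have := nbhs_right_le e0; apply: filterS => t te y xy.
by apply: he => /=; exact: lt_le_trans te.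
Qed.

Lemma open_overlap_interiors : open (overlap_interiors al be).
Proof. by apply: bigcup_open => k _; exact: interval_open. Qed.

(** A common radius [e] works on all sides of all overlaps, since the inverse
    maps are continuous, the interiors are open and the overlaps are
    finitely many. *)
Lemma admissible_exists (eta omega : 'I_s -> seq 'I_m) :
  (forall k, overlap_interiors al be (inv_word_map r d (eta k) (al k)) /\
             overlap_interiors al be (inv_word_map r d (omega k) (be k))) ->
  exists (dal dbe : 'I_s -> R) (l : nat),
    admissible_radii r d al be eta omega dal dbe /\
    admissible_length r d a b dal dbe l.
Proof.
move=> hw; case: hH => _ albe _ sep.
have [e [e0 heta homega hsep]] : exists e : R, [/\ 0 < e,
    forall k y, `|al k - y| < e -> overlap_interiors al be (inv_word_map r d (eta k) y),
    forall k y, `|be k - y| < e -> overlap_interiors al be (inv_word_map r d (omega k) y) &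
    forall k l : 'I_s, (k < l)%N -> be k + e < al l - e].
  apply: (@filter_ex _ (0 : R)^'+).
  near=> e; split.
  - by near: e; exact: nbhs_right_gt.
  - near: e; apply: filter_forall => k; have [hk _] := hw k.
    apply: near_right0_preimage => //; last exact: open_overlap_interiors.
    exact: inv_word_map_continuous.
  - near: e; apply: filter_forall => k; have [_ hk] := hw k.
    apply: near_right0_preimage => //; last exact: open_overlap_interiors.
    exact: inv_word_map_continuous.
  - near: e; apply: filter_forall => k; apply: filter_forall => l.
    have [kl|_] := ltnP k l; last by apply: nearW.
    have {}kl := sep _ _ kl.
    have h0 : 0 < (al l - be k) / 2 by rewrite divr_gt0// subr_gt0.
    by have := nbhs_right_lt h0; apply: filterS => e he _; lra.
have [l hl] : exists l, max_ratio r ^+ l.+2 * (b - a) < e.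
  have : (max_ratio r ^+ n * (b - a)) @[n --> \oo] --> (0 : R).
    rewrite -[0](mul0r (b - a)); apply: cvgMl; apply: cvg_expr.
    exact: max_ratio_lt1.
  move/cvgr0Pnorm_lt => /(_ _ e0)[N _ hN]; exists N.
  apply: le_lt_trans (ler_norm _) (hN N.+2 _) => /=.
  by rewrite ltnW// ltnS leqnSn.
(* The infimum over an empty family would be [0], which no length is below. *)
have s0 := overlap_exists.
exists (fun=> e), (fun=> e), l; split.
  split=> //.
  - move=> k _ [y ky <-]; apply: heta; move: ky; rewrite /= in_itv/= => /andP[h1 h2].
    by rewrite gtr0_norm ?subr_gt0//; lra.
  - move=> k _ [y ky <-]; apply: homega; move: ky; rewrite /= in_itv/= => /andP[h1 h2].
    by rewrite ltr0_norm ?subr_lt0//; lra.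
  - move=> k k' kk'; apply/seteqP; split=> // x [] /=.
    rewrite !in_itv/= => /andP[h1 h2] /andP[h3 h4].
    move: kk'; rewrite neq_ltn => /orP[] /hsep; lra.
move=> w.
rewrite /min_radius setUid (_ : range _ = [set e]); last first.
  apply/seteqP; split=> [_ [k _ <-]//|_ ->].
  by exists (Ordinal s0).
rewrite inf1; apply: le_lt_trans hl; apply: le_trans (ler_norm _) _.
apply: le_trans (word_map_lip d hr _ _ _) _.
by rewrite size_tuple gtr0_norm// subr_gt0.
Unshelve. all: by end_near. Qed.

Section Allowed.
Variable l : nat.
Local Notation W := (allowed r d K al be l).

(** The [n]-th point of the orbit lies in the image of [K] under the [n]-th
    block. *)
Lemma allowed_code_univoque c : allowed_code W c -> univ c.
Proof.
move=> cW; apply/univoque_codes_avoid => n cn.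
have := cW n; rewrite inE => /asboolPn; apply.
exists (proj (shift_code n c)); split=> //.
exists (proj (shift_code l.+2 (shift_code n c))); first exact: coding_proj_itv.
by rewrite -(coding_proj_word hr hK).
Qed.

(** If a block of a univoque code meets [H_k], the corresponding orbit point [y]
    is within the minimal radius of [H_k] without belonging to it, so [eta k]
    or [omega k] sends [y] into an overlap, where a univoque image of [y]
    cannot be. *)
Lemma univoque_allowed_code eta omega (dal dbe : 'I_s -> R) c :
  admissible_radii r d al be eta omega dal dbe ->
  admissible_length r d a b dal dbe l -> univ c -> allowed_code W c.
Proof.
move=> [rpos heta homega _] hlen.
have min_le k : min_radius dal dbe <= dal k /\ min_radius dal dbe <= dbe k.
  have lb : has_lbound (range dal `|` range dbe).
    by exists 0 => _ [[i _ <-]|[i _ <-]]; have [/ltW ? /ltW] := rpos i.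
  by split; apply: ge_inf => //; [left|right]; exists k.
move=> + n => /(univoque_codes_shift hr hK n); move: (shift_code n c) => {n}c cU.
rewrite inE; apply/asboolPn => -[z [wz [k _ kz]]].
have cy : (word_map r d (code_prefix l.+2 c) @` K) (proj c).
  exists (proj (shift_code l.+2 c)); first exact: coding_proj_itv.
  by rewrite -(coding_proj_word hr hK).
(* No [T_w] can send the point into an overlap. *)
have absurd w : overlap_interiors al be (inv_word_map r d w (proj c)) -> False.
  move=> wO; have wU := overlap_interiors_sub wO.
  have [e eE] : exists e, proj e = inv_word_map r d w (proj c).
    apply: (exists_coding hr hK); have /overlap_unionP[i [_ [_ [x Kx <-] _]]] := wU.
    exact: ifs_map_itv.
  have /univoque_codes_avoid/(_ 0%N) : univ e.
    by apply: (univoque_codes_suffix hr hK (w := w) cU); rewrite eE (inv_word_mapK d hr).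
  by apply; rewrite -[shift_code 0 e]/(e) eE.
have /univoque_codes_avoid/(_ 0%N) cO := cU.
move/(word_map_image d hr): wz => /andP[wz1 wz2].
move/(word_map_image d hr): cy => /andP[wy1 wy2].
have := hlen (code_prefix l.+2 c); have [mk1 mk2] := min_le k => wlen.
move: kz; rewrite /= in_itv/= => /andP[zk1 zk2].
have [yk|ky] := ltP (proj c) (al k).
  apply: (@absurd (eta k)); apply: heta; exists (proj c) => //.
  by rewrite /= in_itv/= yk andbT; lra.
have [yk|yk] := ltP (be k) (proj c).
  apply: (@absurd (omega k)); apply: homega; exists (proj c) => //.
  by rewrite /= in_itv/= yk /=; lra.
by apply: cO; exists k => //=; rewrite in_itv/= ky.
Qed.

End Allowed.

(** When neither interval contains the other, [f_i @` K] minus [f_j @` K] and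
    [f_j @` K] minus [f_i @` K] lie on opposite sides of each other, so their
    hulls cannot share the point [t]. *)
Lemma first_level_separated (i j : 'I_m) (x x' y y' t : R) :
  (f i @` K) x -> ~ (f j @` K) x -> (f i @` K) x' -> ~ (f j @` K) x' ->
  (f j @` K) y -> ~ (f i @` K) y -> (f j @` K) y' -> ~ (f i @` K) y' ->
  x <= t <= x' -> y <= t <= y' -> False.
Proof.
rewrite !(ifs_image d hr) => /andP[? ?] /negP + /andP[? ?] /negP +
  /andP[? ?] /negP + /andP[? ?] /negP +.
rewrite !negb_and -!ltNge => /orP nx /orP nx' /orP ny /orP ny' /andP[? ?] /andP[? ?].
case: nx => ?; case: nx' => ?; case: ny => ?; case: ny' => ?; lra.
Qed.

(** Removing a common first digit reduces to the case of different first
    digits, where univoque points lie in only one of the two intervals. *)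
Lemma cylinder_hulls_disjoint n cx cx' cy cy' t :
  univ cx -> univ cx' -> univ cy -> univ cy' ->
  mkseq cx n = mkseq cx' n -> mkseq cy n = mkseq cy' n -> mkseq cx n <> mkseq cy n ->
  proj cx <= t <= proj cx' -> proj cy <= t <= proj cy' -> False.
Proof.
elim: n cx cx' cy cy' t => // n IH cx cx' cy cy' t xU xU' yU yU'.
rewrite !mkseq_cons => -[x0 xs] [y0 ys] xy.
have inI c : (f (c 0%N) @` K) (proj c).
  exists (proj (shift_code 1 c)); first exact: coding_proj_itv.
  by rewrite -(coding_proj_cons hr hK).
have [E|/eqP NE] := eqVneq (cx 0%N) (cy 0%N).
  have E' : cy' 0%N = cx 0%N by rewrite E y0.
  rewrite (coding_proj_cons hr hK cx) (coding_proj_cons hr hK cx').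
  rewrite (coding_proj_cons hr hK cy).
  rewrite (coding_proj_cons hr hK cy') -x0 E' -E -[t](inv_mapK d hr (cx 0%N)).
  rewrite !(ifs_map_le d hr) => xt yt.
  apply: (IH _ _ _ _ _ _ _ _ _ xs ys _ xt yt); try exact: univoque_codes_shift.
  by move=> ss; apply: xy; rewrite E ss.
move=> xt yt.
have digit c i : univ c -> i <> c 0%N -> ~ (f i @` K) (proj c).
  by move=> cU ic /(univoque_codes_digit hr hK cU).
apply: (@first_level_separated (cx 0%N) (cy 0%N)
  (proj cx) (proj cx') (proj cy) (proj cy') t) => //.
- by apply: digit => // /esym.
- by rewrite x0.
- by apply: digit => //; rewrite -x0 => /esym.
- exact: digit.
- by rewrite y0.
- by apply: digit => //; rewrite -y0.
Qed.

End Overlaps.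

(** * The graph-directed construction on the cylinders *)

Section UnivoqueGraph.
Variables (R : realType) (m : nat) (r d : 'I_m -> R).
Hypothesis hr : forall j, 0 < r j < 1.
Variables (a b : R).
Hypothesis hK : is_attractor r d `[a, b]%classic.
Variables (s : nat) (al be : 'I_s -> R) (l : nat).

Local Notation f := (ifs_map r d).
Local Notation K := (`[a, b]%classic : set R).
Local Notation proj := (coding_proj r d).
Local Notation univ := (univoque_codes r d K).
Local Notation W := (allowed r d K al be l).
Local Notation G := (univoque_gd r d K al be l).
Local Notation cyl u := (univoque_cylinder r d K u).

Hypothesis univ_allowed : forall c, univ c <-> allowed_code W c.

Lemma univoque_cylinderP (u : l.+1.-tuple 'I_m) x :
  cyl u x <-> exists c, [/\ allowed_code W c, code_prefix l.+1 c = u & proj c = x].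
Proof.
split=> [[c [cU cu] cx]|[c [cW cu cx]]].
  exists c; split=> //; first exact/univ_allowed.
  apply: eq_from_tnth => i; rewrite -cu (tnth_nth (c i)) nth_mkseq//.
exists c => //; split; first exact/univ_allowed.
by move=> i; rewrite -cu (tnth_nth (c i)) nth_mkseq.
Qed.

Lemma univoque_cylinder_itv (u : l.+1.-tuple 'I_m) : cyl u `<=` K.
Proof. by move=> x /univoque_cylinderP[c [_ _ <-]]; exact: coding_proj_itv. Qed.

Lemma univoque_cylinder_nonempty (u : gd_vertex G) : cyl (val u) !=set0.
Proof.
have [c cW cu] := vertex_code (valP u).
by exists (proj c); apply/univoque_cylinderP; exists c.
Qed.

Definition code_vertex c (cW : allowed_code W c) : gd_vertex G :=
  exist (fun u => u \in vertices W) (code_prefix l.+1 c) (allowed_code_vertex cW).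

Lemma univoque_cylinder_edge (u v : gd_vertex G) : gd_edge u v ->
  gd_map u v @` cyl (val v) `<=` cyl (val u).
Proof.
move=> uv _ [_ /univoque_cylinderP[c [cW cv <-]] <-].
have uc : word_edge W (val u) (code_prefix l.+1 c) by rewrite cv.
apply/univoque_cylinderP; exists (cons_code (thead (val u)) c); split.
- exact: allowed_code_cons.
- by have [] := edge_cons_code uc.
- exact: (coding_proj_cons hr hK).
Qed.

Lemma univoque_cylinder_split (u : gd_vertex G) : cyl (val u) `<=`
  \bigcup_(v in [set v | gd_edge u v]) (gd_map u v @` cyl (val v)).
Proof.
move=> _ /univoque_cylinderP[c [cW cu <-]].
have sW := allowed_code_shift 1 cW.
exists (code_vertex sW) => /=.
  by rewrite -cu; exact: allowed_code_edge.
exists (proj (shift_code 1 c)); last first.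
  by rewrite /gd_map /= -cu [RHS](coding_proj_cons hr hK).
by apply/univoque_cylinderP; exists (shift_code 1 c).
Qed.

(** Following a point of [C u] backwards yields an infinite path from [u] and a
    bounded orbit, so the point is coded by that path. *)
Lemma subinvariant_cylinder (C : gd_vertex G -> set R) (M : R) :
  (forall u x, C u x -> `|x| <= M) ->
  (forall u, C u `<=` \bigcup_(v in [set v | gd_edge u v]) (gd_map u v @` C v)) ->
  forall u, C u `<=` cyl (val u).
Proof.
move=> CM CE u x Cx.
pose Y := {p : gd_vertex G * R | C p.1 p.2}.
have [g gP] : {g : Y -> Y & forall y, gd_edge (sval y).1 (sval (g y)).1 /\
    (sval y).2 = gd_map (sval y).1 (sval (g y)).1 (sval (g y)).2}.
  apply: (@choice _ _ (fun y y' : Y => gd_edge (sval y).1 (sval y').1 /\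
    (sval y).2 = gd_map (sval y).1 (sval y').1 (sval y').2)) => -[[v y] /= Cy].
  have [w vw [z Cz <-]] := CE _ _ Cy.
  by exists (exist _ (w, z) Cz).
pose y n := iter n g (exist _ (u, x) Cx : Y).
pose p n := val (sval (y n)).1.
have pE n : word_edge W (p n) (p n.+1) by have [] := gP (y n).
apply/univoque_cylinderP; exists (fun n => thead (p n)); split.
- exact: path_allowed_code.
- exact: (path_code_prefix pE 0).
- apply: (@coding_orbit _ _ _ _ hr _ _ hK _ (fun n => (sval (y n)).2) M) => n.
    by apply: (CM (sval (y n)).1); exact: (svalP (y n)).
  by have [] := gP (y n).
Qed.

Lemma gd_map_continuous (u v : gd_vertex G) : continuous (gd_map u v).
Proof. exact: ifs_map_continuous. Qed.

(** The closures of the cylinders satisfy the inclusions of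
    [subinvariant_cylinder], because a finite union of images of compact sets
    is closed; so they are contained in the cylinders. *)
Lemma univoque_cylinder_compact (u : gd_vertex G) : compact (cyl (val u)).
Proof.
have cK (v : gd_vertex G) : closure (cyl (val v)) `<=` K.
  have clK : closed K by exact: interval_closed.
  rewrite [X in _ `<=` X]((closure_id _).1 clK).
  by apply: closureS; exact: univoque_cylinder_itv.
have cc (v : gd_vertex G) : compact (closure (cyl (val v))).
  apply: subclosed_compact (cK v); first exact: closed_closure.
  exact: segment_compact.
suff cl (v : gd_vertex G) : closure (cyl (val v)) `<=` cyl (val v).
  have -> : cyl (val u) = closure (cyl (val u)).
    by apply/seteqP; split; [exact: subset_closure|exact: cl].
  exact: cc.
apply: (@subinvariant_cylinder
  (fun v : gd_vertex G => closure (cyl (val v))) (`|a| + `|b|)) => {}v.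
  move=> x /cK; rewrite /= in_itv/= => /andP[ax xb].
  have := ler_norm b; have := ler_norm (- a); rewrite normrN => ha hb.
  have := normr_ge0 a; have := normr_ge0 b.
  by move=> ? ?; rewrite ler_norml; apply/andP; split; lra.
have clU : closed (\bigcup_(w in [set w | gd_edge v w])
    (gd_map v w @` closure (cyl (val w)))).
  apply: closed_bigcup => [|w _]; first exact: finite_finset.
  apply: compact_closed; first exact: Rhausdorff.
  apply: continuous_compact => //.
  by apply: continuous_subspaceT => x; exact: gd_map_continuous.
rewrite [X in _ `<=` X]((closure_id _).1 clU); apply: closureS => x.
move=> /univoque_cylinder_split[w vw [z wz <-]]; exists w => //.
by exists z => //; exact: subset_closure.
Qed.

Lemma univoque_cylinder_invariant : @gd_invariant R G (fun u => cyl (val u)).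
Proof.
move=> u; split.
- exact: univoque_cylinder_nonempty.
- exact: univoque_cylinder_compact.
- apply/seteqP; split; first exact: univoque_cylinder_split.
  by move=> x [v uv vx]; exact: (univoque_cylinder_edge uv).
Qed.

Lemma gd_invariant_bounded (C : gd_vertex G -> set R) : gd_invariant C ->
  exists M, forall u x, C u x -> `|x| <= M.
Proof.
move=> CI.
suff : \forall M \near +oo, forall u x, C u x -> `|x| <= M by move/filter_ex.
apply: filter_forall => u; have [_ cC _] := CI u.
exact: (compact_bounded cC).
Qed.

(** One inclusion is [subinvariant_cylinder].  For the other, push arbitrary
    points [z n] of [C] forward along the path of a code: the images lie in
    [C u], which is closed, and converge to the point coded. *)
Lemma gd_invariant_cylinder (C : gd_vertex G -> set R) : gd_invariant C ->
  (fun u : gd_vertex G => cyl (val u)) = C.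
Proof.
move=> CI; have [M CM] := gd_invariant_bounded CI.
apply: funext => u; apply/seteqP; split; last first.
  by apply: (subinvariant_cylinder CM) => v x; have [_ _ {1}->] := CI v.
move=> x /univoque_cylinderP[c [cW cu <-]].
pose p n : gd_vertex G := code_vertex (allowed_code_shift n cW).
have p0 : p 0%N = u by apply: val_inj; rewrite /= -cu.
have [z Cz] : {z : nat -> R & forall n, C (p n) (z n)}.
  by apply: (@choice _ _ (fun n y => C (p n) y)) => n; have [] := CI (p n).
(* Generalised over the starting index of the path for the induction. *)
have Cw n i : C (p i) (word_map r d (mkseq (shift_code i c) n) (z (i + n)%N)).
  elim: n i => [|n IH] i; first by rewrite addn0; exact: Cz.
  have pE : gd_edge (p i) (p i.+1).
    rewrite /= -(shift_codeS c i); apply: allowed_code_edge.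
    exact: allowed_code_shift.
  have [_ _ ->] := CI (p i); exists (p i.+1); first exact: pE.
  exists (word_map r d (mkseq (shift_code i.+1 c) n) (z (i.+1 + n)%N)); first exact: IH.
  by rewrite mkseq_cons word_map_cons shift_codeS addSnnS.
have zM n : `|z n| <= M by exact: CM (Cz n).
have [_ cC _] := CI u.
have nearC : \forall n \near \oo, C u (word_map r d (mkseq c n) (z n)).
  by apply: nearW => n; rewrite -p0; exact: (Cw n 0%N).
apply: (closed_cvg _ _ nearC); last exact: (coding_proj_cvg hr hK zM).
by apply: compact_closed => //; exact: Rhausdorff.
Qed.

Lemma univoque_gd_set : is_gd_set G (univoque r d K).
Proof.
exists (fun u => cyl (val u)); split.
  by split; [exact: univoque_cylinder_invariant|exact: gd_invariant_cylinder].
apply/seteqP; split=> [x xU|x [u _ [c [cU _] <-]]//].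
have [_ [c [cx _]]] := xU.
have cW : allowed_code W c by apply/univ_allowed; rewrite /univoque_codes /= cx.
exists (code_vertex cW) => //.
by apply/univoque_cylinderP; exists c.
Qed.

(** The endpoints of [J_u] belong to [K_u]; disjointness and inclusions of the
    hulls are then statements about univoque points. *)
Lemma univoque_gd_itv (u : gd_vertex G) : exists p q,
  [/\ cyl (val u) p, cyl (val u) q, cyl (val u) `<=` `[p, q] & gd_itv u = `[p, q]%classic].
Proof.
by apply: Rhull_compact; [exact: univoque_cylinder_nonempty|exact: univoque_cylinder_compact].
Qed.

Lemma univoque_gd_itv_disjoint (u v : gd_vertex G) : u != v ->
  gd_itv u `&` gd_itv v = set0.
Proof.
move=> uv; have [p [q [up uq _ ->]]] := univoque_gd_itv u.
have [p' [q' [vp vq _ ->]]] := univoque_gd_itv v.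
apply/seteqP; split=> // t [] /=; rewrite !in_itv/=.
have [cp [pW pu <-]] := (univoque_cylinderP _ _).1 up.
have [cq [qW qu <-]] := (univoque_cylinderP _ _).1 uq.
have [cp' [pW' pv <-]] := (univoque_cylinderP _ _).1 vp.
have [cq' [qW' qv <-]] := (univoque_cylinderP _ _).1 vq.
have tu c (w : l.+1.-tuple 'I_m) : code_prefix l.+1 c = w -> mkseq c l.+1 = w by move=> <-.
apply: (@cylinder_hulls_disjoint _ _ _ _ hr _ _ hK l.+1 cp cq cp' cq' t);
  rewrite ?(tu _ _ pu) ?(tu _ _ qu) ?(tu _ _ pv) ?(tu _ _ qv) //; try exact/univ_allowed.
by move=> /val_inj/val_inj E; move: uv; rewrite E eqxx.
Qed.

Lemma univoque_gd_construction : gd_construction G.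
Proof.
have inc (u v : gd_vertex G) : {mono gd_map u v : x y / x <= y} by exact: ifs_map_le.
split.
- move=> u; have [p [q [up uq upq ->]]] := univoque_gd_itv u; exists p, q; split=> //.
  by have := upq _ up; rewrite /= in_itv/= => /andP[].
- exact: univoque_gd_itv_disjoint.
- move=> u; have [v vV uv] := vertices_next (valP u).
  by exists (exist (fun w => w \in vertices W) v vV).
- by move=> u v _; exact: hr.
- move=> u; split=> [x [v uv [y vy <-]]|v w uv uw vw].
    have [p [q [up uq upq ->]]] := univoque_gd_itv u.
    move: vy; have [p' [q' [vp vq _ ->]]] := univoque_gd_itv v.
    rewrite /= !in_itv/= => /andP[py yq].
    have /upq : cyl (val u) (gd_map u v p') by apply: (univoque_cylinder_edge uv); exists p'.
    have /upq : cyl (val u) (gd_map u v q') by apply: (univoque_cylinder_edge uv); exists q'.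
    rewrite /= !in_itv/= => /andP[_ q1] /andP[p1 _].
    by rewrite (le_trans p1) ?inc// (le_trans _ q1) ?inc.
  apply/seteqP; split=> // x [[y vy <-] [z wz zy]].
  have E : z = y by apply: (@ifs_map_inj _ _ r d hr (thead (val u))); exact: zy.
  have : (gd_itv v `&` gd_itv w) y by split=> //; rewrite -E.
  by rewrite univoque_gd_itv_disjoint.
Qed.

End UnivoqueGraph.

(** * The univoque set is graph-directed self-similar *)

Theorem mainTheorem2 (R : realType) (m : nat) (r d : 'I_m -> R)
  (hr : forall j, 0 < r j < 1)
  (a b : R) (hab : a < b) (hK : is_attractor r d `[a, b]%classic)
  (s : nat) (al be : 'I_s -> R) (hH : overlaps r d `[a, b]%classic al be)
  (hwords : forall k : 'I_s, exists eta omega : seq 'I_m,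
     overlap_interiors al be (inv_word_map r d eta (al k)) /\
     overlap_interiors al be (inv_word_map r d omega (be k))) :
  (forall eta omega : 'I_s -> seq 'I_m,
     (forall k : 'I_s,
        overlap_interiors al be (inv_word_map r d (eta k) (al k)) /\
        overlap_interiors al be (inv_word_map r d (omega k) (be k))) ->
     (exists (dal dbe : 'I_s -> R) (l : nat),
        admissible_radii r d al be eta omega dal dbe /\
        admissible_length r d a b dal dbe l) /\
     (forall (dal dbe : 'I_s -> R) (l : nat),
        admissible_radii r d al be eta omega dal dbe ->
        admissible_length r d a b dal dbe l ->
        gd_construction (univoque_gd r d `[a, b]%classic al be l) /\
        is_gd_set (univoque_gd r d `[a, b]%classic al be l) (univoque r d `[a, b]%classic))) /\
  gd_self_similar (univoque r d `[a, b]%classic).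
Proof.
have main eta omega : (forall k : 'I_s,
    overlap_interiors al be (inv_word_map r d (eta k) (al k)) /\
    overlap_interiors al be (inv_word_map r d (omega k) (be k))) ->
  (exists (dal dbe : 'I_s -> R) (l : nat),
    admissible_radii r d al be eta omega dal dbe /\
    admissible_length r d a b dal dbe l) /\
  (forall (dal dbe : 'I_s -> R) (l : nat),
    admissible_radii r d al be eta omega dal dbe ->
    admissible_length r d a b dal dbe l ->
    gd_construction (univoque_gd r d `[a, b]%classic al be l) /\
    is_gd_set (univoque_gd r d `[a, b]%classic al be l) (univoque r d `[a, b]%classic)).
  move=> hw; split; first exact: (admissible_exists hr hab hK hH).
  move=> dal dbe l hrad hlen.
  have univ_allowed c : univoque_codes r d `[a, b]%classic c <->
      allowed_code (allowed r d `[a, b]%classic al be l) c.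
    split; first exact: (univoque_allowed_code hr hK hH hrad hlen).
    exact: (allowed_code_univoque hr hK hH).
  by split; [exact: univoque_gd_construction|exact: univoque_gd_set].
split; first exact: main.
have [eta hw] := choice hwords; have [omega {}hw] := choice hw.
have [[dal [dbe [l [hrad hlen]]]] gdP] := main _ _ hw.
by exists (univoque_gd r d `[a, b]%classic al be l); exact: gdP hrad hlen.
Qed.
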